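(* Let $G=(G_l,\ldots,G_1)$ be a polynomial complex of size $q\times(p_l,\ldots,p_1)$ with column degree table $(a_l,\ldots,a_1)$, and let $C=\mathrm{Im}(G_1)\subseteq S^q$. Let $G^H=(G_l^H,\ldots,G_1^H)$ be its homogenization and $G^L=(G_l^L,\ldots,G_1^L)$ its leading term complex. The following three conditions are equivalent: (a) $G$ has the PD (predictable degree) property; (b) $\mathrm{Im}(G_1^H)=C^H$ and the complex of graded $T$-modules $$0\to T^{p_l}(-a_l)\xrightarrow{G_l^H}\cdots\xrightarrow{G_2^H}T^{p_1}(-a_1)\xrightarrow{G_1^H}T^q(0)$$ is exact; (c) $G$ is a polynomial resolution and the complex of graded $S$-modules $$0\to S^{p_l}(-a_l)\xrightarrow{G_l^L}\cdots\xrightarrow{G_2^L}S^{p_1}(-a_1)\xrightarrow{G_1^L}S^q(0)$$ is exact. (Exactness of the sequences in (b) and (c) means exactness at every term except the rightmost one.)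
   Context: Setting. $\mathbb F$ is an arbitrary field, $n\ge 1$ an integer, $D=(D_1,\ldots,D_n)$ indeterminates, $S=\mathbb F[D]$, and $T=\mathbb F[D_0,D]$ with one extra indeterminate $D_0$. $S_{\le d}$ is the space of polynomials of (total) degree $\le d$ ($d\in\mathbb Z$); $T_d$ is the space of homogeneous polynomials of degree $d$ (together with $0$). All polynomial matrices considered are assumed to have no zero column. Degrees. A twisting (degree) function of length $p$ is a function $a:[1,p]=\{1,\ldots,p\}\to\mathbb Z_+=\{0,1,2,\ldots\}$. For $f\in S^p$, $\deg_a(f)=\max_i\{a(i)+\deg(f_i)\}$ (and $-\infty$ if $f=0$). For $G\in S^{p\times q}$ with no zero column, $\deg_a(G):[1,q]\to\mathbb Z_+$ sends $j$ to the $a$-degree of the $j$-th column of $G$. Polynomial complexes. A polynomial complex of length $l\ge 1$ and size $q\times(p_l,\ldots,p_1)$ ($p_i\geq 1$) is a sequence $(G_l,\ldots,G_1)$ of matrices over $S$, where $G_1$ is $q\times p_1$ and $G_i$ is $p_{i-1}\times p_i$ for $i\ge2$, such that $G_1G_2=0,\ldots,G_{l-1}G_l=0$. It is a polynomial resolution if $0\to S^{p_l}\xrightarrow{G_l}\cdots\to S^{p_1}\xrightarrow{G_1}S^q$ is exact (at every term except $S^q$). Its column degree table $(a_l,\ldots,a_1)$ is defined recursively by $a_0=0$ (the zero function on $[1,q]$; put $p_0=q$) and $a_{i+1}=\deg_{a_i}(G_{i+1})$, a twisting function of length $p_{i+1}$. PD property. For a twisting function $a$ of length $p$ and $d\ge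 0$ let $S^p[-a]_{\le d}=\{f\in S^p:\deg_a(f)\le d\}$. For a submodule $C\subseteq S^q$ let $C_{\le d}=C\cap (S_{\le d})^q$. A polynomial complex $G=(G_l,\ldots,G_1)$ of size $q\times(p_l,\ldots,p_1)$ with column degree table $(a_l,\ldots,a_1)$, and with $C=\mathrm{Im}(G_1)$, has the PD property if for every $d\ge0$ the sequence of $\mathbb F$-vector spaces $$0\to S^{p_l}[-a_l]_{\le d}\xrightarrow{G_l}\cdots\xrightarrow{G_2}S^{p_1}[-a_1]_{\le d}\xrightarrow{G_1}C_{\le d}\to0$$ is exact (at every term). Graded modules. For $R=S$ or $R=T$ and a twisting function $a$ of length $p$, $R^p(-a)$ is the module $R^p$ with the gradation $R^p(-a)_d=\{f\in R^p: f_i \text{ is homogeneous of degree } d-a(i) \text{ or zero, for all } i\}$, $d\ge0$; $R^q(0)$ is the case $a=0$. Homogenization. The homogenization in degree $d$ is the linear bijection $S_{\le d}\to T_d$, $f(D)\mapsto D_0^d f(D_1/D_0,\ldots,D_n/D_0)$, applied componentwise to vectors. For a submodule $C\subseteq S^q$, $C^H=\bigoplus_{d\ge0}C^H_d\subseteq T^q$, where $C_d^H$ is the image of $C_{\le d}$ under homogenization in degree $d$. For a twisting function $a$ of length $p$, $D_0^{a}$ is the diagonal matrix with entries $D_0^{a(1)},\ldots,D_0^{a(p)}$, and $D_0^{-a}$ is its inverse over $\mathbb F(D_0)$. For a polynomial complex $G$, define $G_k^H=D_0^{-a_{k-1}}\,G_k(D_1/D_0,\ldots,D_n/D_0)\,D_0^{a_k}$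 for $k=1,\ldots,l$ (a matrix over $T$). Leading term complex. $G_k^L$ is the matrix over $S$ of the same size as $G_k$ whose $(i,j)$ entry is the homogeneous part of degree $a_k(j)-a_{k-1}(i)$ of the $(i,j)$ entry of $G_k$ (zero if this number is negative). *)

(* Defs.v *)
From mathcomp Require Import all_boot all_order all_algebra.
From mathcomp.multinomials Require Import mpoly.

Set Implicit Arguments.
Unset Strict Implicit.
Unset Printing Implicit Defensive.

Import GRing.Theory.
Local Open Scope ring_scope.

Local Notation "x %:F" := (@tofrac _ x).

(* A sequence R^(p l) -> ... -> R^(p 1) -> R^(p 0) of matrices acting on column
   vectors is a family G with G k : R^(p k.+1) -> R^(p k).  Only the indices
   k < l (k <= l for p) are meaningful; every notion below that takes l ignores
   the values of p and G beyond that range. *)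

Section Sequences.
Variables (R : comNzRingType) (p : nat -> nat) (l : nat).
Variable G : forall k, 'M[R]_(p k, p k.+1).

Definition im_mx (m k : nat) (A : 'M[R]_(m, k)) (v : 'cV[R]_m) : Prop :=
  exists f : 'cV[R]_k, v = A *m f.

(* 0 -> V l -> ... -> V 1 -> V 0 is a well-defined sequence, exact at every term
   except V 0. *)
Definition exact_left (V : forall k, 'cV[R]_(p k) -> Prop) : Prop :=
  [/\ forall k, (k < l)%N ->
        forall f : 'cV[R]_(p k.+1), V k.+1 f -> V k (G k *m f),
      forall k, (k.+1 < l)%N ->
        forall f : 'cV[R]_(p k.+1), V k.+1 f ->
          (G k *m f = 0 <->
           exists2 g : 'cV[R]_(p k.+2), V k.+2 g & f = G k.+1 *m g)
    & forall k, k.+1 = l ->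
        forall f : 'cV[R]_(p k.+1), V k.+1 f -> G k *m f = 0 -> f = 0].

Definition exact_free : Prop := exact_left (fun _ _ => True).

End Sequences.

Section Graded.
Variables (F : fieldType) (n : nat) (p : nat -> nat) (l : nat).
Local Notation S := {mpoly F[n]}.

(* Degree d part of S^m(-a); it is also used with n.+1 variables, for T. *)
Definition graded_part (m : nat) (a : 'I_m -> nat) (d : nat) (f : 'cV[S]_m) :
    Prop :=
  forall i, f i 0 = 0 \/ ((a i <= d)%N /\ f i 0 \is (d - a i)%N.-homog).

(* The maps G k respect the gradations twisted by a, and the underlying sequence
   of modules is exact except at its rightmost term. *)
Definition graded_exact (a : forall k, 'I_(p k) -> nat)
    (G : forall k, 'M[S]_(p k, p k.+1)) : Prop :=
  (forall d k, (k < l)%N -> forall f : 'cV[S]_(p k.+1),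
     graded_part (a k.+1) d f -> graded_part (a k) d (G k *m f))
  /\ exact_free l G.

End Graded.

Section Degrees.
Variables (F : fieldType) (n : nat).
Local Notation S := {mpoly F[n]}.

(* 1 + deg_a f, and 0 when f = 0; the convention is that of [msize], which is
   1 + the total degree. *)
Definition twsize (m : nat) (a : 'I_m -> nat) (f : 'cV[S]_m) : nat :=
  (\max_(i < m | f i 0%R != 0%R) (a i + msize (f i 0%R)))%N.

Definition tw_le (m : nat) (a : 'I_m -> nat) (d : nat) (f : 'cV[S]_m) : Prop :=
  (twsize a f <= d.+1)%N.

Definition sub_le (m : nat) (C : 'cV[S]_m -> Prop) (d : nat) (c : 'cV[S]_m) :
    Prop :=
  C c /\ forall i, (msize (c i 0%R) <= d.+1)%N.

End Degrees.

Section Homogenization.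
Variables (F : fieldType) (n : nat).
Local Notation S := {mpoly F[n]}.
Local Notation T := {mpoly F[n.+1]}.

(* In T the variable 'X_ord0 is D_0 and 'X_(lift ord0 i) is the variable 'X_i
   of S. *)
Definition mon_lift (m : 'X_{1..n}) : T :=
  \prod_(i < n) 'X_(lift ord0 i) ^+ m i.

(* D_0^d f(D_1/D_0, ..., D_n/D_0), for f of degree at most d:
   see [homogenizeE]. *)
Definition homogenize (d : nat) (f : S) : T :=
  \sum_(m <- msupp f) f@_m *: ('X_ord0 ^+ (d - mdeg m) * mon_lift m).

Definition subst_frac (f : S) : {fraction T} :=
  mmap (fun c : F => (c%:MP : T)%:F)
       (fun i : 'I_n => ('X_(lift ord0 i) : T)%:F / ('X_ord0 : T)%:F) f.

Lemma homogenizeE (d : nat) (f : S) : (msize f <= d.+1)%N ->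
  (homogenize d f)%:F = ('X_ord0 : T)%:F ^+ d * subst_frac f.
Proof.
move=> hf; rewrite /homogenize /subst_frac /mmap rmorph_sum mulr_sumr /=.
have X0 : ('X_ord0 : T)%:F != 0.
  by rewrite tofrac_eq0 -msupp_eq0 msuppX.
rewrite big_seq [RHS]big_seq; apply: eq_bigr => m hm.
have dm : (mdeg m <= d)%N by rewrite -ltnS (leq_trans _ hf) // msize_mdeg_lt.
rewrite -mul_mpolyC !tofracM tofracXn [RHS]mulrCA; congr (_ * _).
rewrite /mmap1 /mon_lift rmorph_prod /=.
under [in RHS]eq_bigr => i _ do rewrite expr_div_n.
rewrite big_split /= -{2}(subnK dm) exprD -mulrA; congr (_ * _).
rewrite prodfV prodrXr -mdegE mulrCA divff ?expf_neq0 // mulr1.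
by apply: eq_bigr => i _; rewrite tofracXn.
Qed.

(* [hgen_part C d] is C^H_d and [hgen C] is C^H, the sum of the C^H_d in T^m. *)
Definition hgen_part (m : nat) (C : 'cV[S]_m -> Prop) (d : nat) (v : 'cV[T]_m) :
    Prop :=
  exists2 c : 'cV[S]_m, sub_le C d c & v = map_mx (homogenize d) c.

Definition hgen (m : nat) (C : 'cV[S]_m -> Prop) (v : 'cV[T]_m) : Prop :=
  exists N (w : nat -> 'cV[T]_m),
    (forall d, hgen_part C d (w d)) /\ v = \sum_(d < N) w d.

End Homogenization.

Section Complexes.
Variables (F : fieldType) (n : nat) (p : nat -> nat) (l : nat).
Local Notation S := {mpoly F[n]}.
Local Notation T := {mpoly F[n.+1]}.
Variable G : forall k, 'M[S]_(p k, p k.+1).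

(* G is the complex (G (l-1), ..., G 0) of size p 0 x (p l, ..., p 1), i.e.
   G k is the matrix usually numbered k + 1, and q = p 0. *)
Definition poly_complex : Prop :=
  [/\ (0 < l)%N,
      forall k, (k < l)%N -> (0 < p k.+1)%N,
      forall k, (k < l)%N -> forall j, col j (G k) != 0
    & forall k, (k.+1 < l)%N -> G k *m G k.+1 = 0].

Definition poly_resolution : Prop := exact_free l G.

(* The column degree table: [coldeg k] is a_k. *)
Fixpoint coldeg (k : nat) : 'I_(p k) -> nat :=
  match k with
  | 0%N => fun _ => 0%N
  | k'.+1 => fun j => (twsize (coldeg (k := k')) (col j (G k'))).-1
  end.

Definition PD : Prop :=
  forall d : nat,
    exact_left l G (fun k => tw_le (@coldeg k) d)
    /\ forall c : 'cV[S]_(p 0%N),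
         sub_le (im_mx (G 0%N)) d c <->
         exists2 f : 'cV[S]_(p 1%N), tw_le (@coldeg 1) d f & c = G 0%N *m f.

(* A nonzero entry (i, j) of G k has degree at most coldeg j - coldeg i, so the
   truncated subtraction is harmless: see [cplxH_E]. *)
Definition cplxH (k : nat) : 'M[T]_(p k, p k.+1) :=
  \matrix_(i, j) homogenize (coldeg j - coldeg i)%N (G k i j).

Lemma coldegP k i j : G k i j != 0 ->
  (coldeg i + msize (G k i j) <= (coldeg j).+1)%N.
Proof.
move=> h; have hc : col j (G k) i 0 != 0 by rewrite mxE.
have E : col j (G k) i 0 = G k i j by rewrite mxE.
apply: leq_trans (leqSpred _); rewrite -E.
exact: (leq_bigmax_cond (F := fun i =>
  (coldeg i + msize (col j (G k) i 0%R))%N) i hc).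
Qed.

(* D_0^(-a_k) (G k)(D_1/D_0, ..., D_n/D_0) D_0^(a_(k+1)), over the fractions. *)
Lemma cplxH_E k :
  map_mx (@tofrac _) (cplxH k) =
  diag_mx (\row_i ('X_ord0 : T)%:F ^- coldeg i)
    *m map_mx (@subst_frac F n) (G k)
    *m diag_mx (\row_j ('X_ord0 : T)%:F ^+ coldeg j).
Proof.
apply/matrixP => i j; rewrite mul_mx_diag mul_diag_mx !mxE.
have [->|h] := eqVneq (G k i j) 0.
  rewrite /homogenize /subst_frac /mmap msupp0 !big_nil.
  by rewrite tofrac0 mulr0 mul0r.
have := coldegP h.
have : (0 < msize (G k i j))%N by rewrite lt0n msize_poly_eq0.
move=> s0 hs.
have le_ij : (coldeg i <= coldeg j)%N.
  by rewrite -ltnS (leq_trans _ hs) // -addn1 leq_add2l.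
have X0 : ('X_ord0 : T)%:F != 0 by rewrite tofrac_eq0 -msupp_eq0 msuppX.
rewrite homogenizeE; last by rewrite -subSn // leq_subRL // (leq_trans le_ij).
rewrite expfB_cond ?(negPf X0) // [RHS]mulrAC; congr (_ * _); exact: mulrC.
Qed.

(* [coldeg j < coldeg i] is the case of a negative degree. *)
Definition cplxL (k : nat) : 'M[S]_(p k, p k.+1) :=
  \matrix_(i, j)
    if (coldeg i <= coldeg j)%N
    then pihomog mdeg (coldeg j - coldeg i) (G k i j) else 0.

End Complexes.

(* Main.v *)
(* Homogenization in degree d is a bijection between the vectors of twisted
   degree at most d and the graded part of degree d, inverse to D_0 := 1; it
   turns G into G^H, and since a graded sequence is exact iff it is so in every
   degree, (a) is (b) read degree by degree.  Setting D_0 := 0 instead turns G^H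
   into G^L, so the part of degree d of G f is G^L applied to that of f.  For a
   resolution, the PD property says that any G f of degree at most d equals some
   G g with g of degree at most d; this follows from exactness of G^L by
   cancelling leading parts, and conversely lifts a cycle of G^L to a cycle of G
   with that leading part. *)
Require Import Defs.
From HB Require Import structures.
From mathcomp Require Import all_boot all_order all_algebra.
From mathcomp Require Import bigenough.
From mathcomp.multinomials Require Import ssrcomplements mpoly.

Set Implicit Arguments.
Unset Strict Implicit.
Unset Printing Implicit Defensive.

Import GRing.Theory BigEnough.
Local Open Scope ring_scope.

(** * Substituting a scalar for $D_0$; inverting homogenization *)

Section Specialization.
Variables (F : fieldType) (n : nat).
Local Notation S := {mpoly F[n]}.
Local Notation T := {mpoly F[n.+1]}.
Implicit Types (c : F) (d : nat) (f : S) (t : T).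

Definition spec_var c (i : 'I_n.+1) : S :=
  if unlift ord0 i is Some j then 'X_j else c%:MP.

(* The substitution D_0 := c: dehomogenization for c = 1, and leading terms for
   c = 0. *)
Definition spec c : T -> S := mmap (@mpolyC n F) (spec_var c).

HB.instance Definition _ c := GRing.RMorphism.copy (spec c)
  (mmap (@mpolyC n F) (spec_var c)).

Lemma specZ c x t : spec c (x *: t) = x *: spec c t.
Proof. by rewrite /spec mmapZ mul_mpolyC. Qed.

Lemma spec_X c i : spec c 'X_i = spec_var c i.
Proof. by rewrite /spec mmapX mmap1U. Qed.

Lemma spec_X0 c : spec c 'X_ord0 = c%:MP.
Proof. by rewrite spec_X /spec_var unlift_none. Qed.

Lemma spec_mon_lift c (m : 'X_{1..n}) : spec c (mon_lift F m) = 'X_[m].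
Proof.
rewrite rmorph_prod mpolyXE_id; apply: eq_bigr => i _ /=.
by rewrite rmorphXn /= spec_X /spec_var liftK.
Qed.

Lemma spec_homogenize c d f :
  spec c (homogenize d f) =
  \sum_(m <- msupp f) (f@_m * c ^+ (d - mdeg m)) *: 'X_[m].
Proof.
rewrite rmorph_sum; apply: eq_bigr => m _ /=.
rewrite specZ rmorphM rmorphXn /= spec_X0 spec_mon_lift.
by rewrite -[in LHS]rmorphXn /= mul_mpolyC scalerA.
Qed.

Lemma spec1_homogenize d f : spec 1 (homogenize d f) = f.
Proof.
rewrite spec_homogenize [RHS]mpolyE; apply: eq_bigr => m _.
by rewrite expr1n mulr1.
Qed.

(** At $D_0=0$ a monomial of degree $e\le d$ keeps the factor $0^{d-e}$, which is 1 exactly when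
    $e=d$. The size bound rules out $e>d$, where truncated subtraction would also give exponent
    0. *)
Lemma spec0_homogenize d f : (msize f <= d.+1)%N ->
  spec 0 (homogenize d f) = pihomog mdeg d f.
Proof.
move=> fd; rewrite spec_homogenize pihomogE [RHS]big_mkcond.
rewrite big_seq [RHS]big_seq; apply: eq_bigr => m /msize_mdeg_lt fm.
have md : (mdeg m <= d)%N by rewrite -ltnS (leq_trans fm).
rewrite expr0n subn_eq0 eqn_leq md /=.
by case: leqP; rewrite ?mulr1 ?mulr0 ?scale0r.
Qed.

(** The index set no longer depends on [f], so polynomials with different supports can be added term
    by term; this is how linearity is proved. *)
Lemma homogenizewE d k f : (msize f <= k)%N ->
  homogenize d f =
  \sum_(m : 'X_{1..n < k}) f@_m *: ('X_ord0 ^+ (d - mdeg m) * mon_lift F m).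
Proof.
move=> fk; rewrite /homogenize; set I : subFinType _ := 'X_{1..n < k}.
rewrite (big_mksub I) ?msupp_uniq //=; last first.
  by move=> m /msize_mdeg_lt /leq_trans; apply.
by rewrite big_rmcond //= => m /memN_msupp_eq0 ->; rewrite scale0r.
Qed.

Lemma homogenize_is_linear d : linear (@homogenize F n d).
Proof.
move=> c f g /=; pose_big_enough k.
  rewrite !(@homogenizewE d k) // scaler_sumr -big_split /=.
  by apply: eq_bigr => m _; rewrite linearP /= scalerDl scalerA.
by close.
Qed.

HB.instance Definition _ d :=
  GRing.isLinear.Build F S T _ (@homogenize F n d) (homogenize_is_linear d).

Lemma homogenize_dhomog d f : (msize f <= d.+1)%N ->
  homogenize d f \is d.-homog.
Proof.
move=> fd; rewrite /homogenize big_seq; apply: rpred_sum => m mf.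
have md : (mdeg m <= d)%N by rewrite -ltnS (leq_trans (msize_mdeg_lt mf)).
apply/rpredZ; rewrite -{2}(subnK md); apply: dhomogM.
  by rewrite mpolyXn dhomogX /= mdegMn mdeg1 mul1n.
rewrite /mon_lift mdegE; elim/big_rec2: _ => [|i e t _ te].
  exact: dhomog1.
by apply: dhomogM => //; rewrite mpolyXn dhomogX /= mdegMn mdeg1 mul1n.
Qed.

Definition mnm_behead (m : 'X_{1..n.+1}) : 'X_{1..n} :=
  [multinom m (lift ord0 i) | i < n].

Lemma mdeg_behead m : mdeg m = (m ord0 + mdeg (mnm_behead m))%N.
Proof.
rewrite !mdegE big_ord_recl; congr addn.
by apply: eq_bigr => i _; rewrite mnmE.
Qed.

Lemma mpolyX_behead m :
  'X_[m] = 'X_ord0 ^+ m ord0 * mon_lift F (mnm_behead m) :> T.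
Proof.
rewrite mpolyXE_id big_ord_recl; congr (_ * _).
by apply: eq_bigr => i _; rewrite mnmE.
Qed.

Lemma spec1_X m : spec 1 'X_[m] = 'X_[mnm_behead m].
Proof.
by rewrite mpolyX_behead rmorphM rmorphXn /= spec_X0 spec_mon_lift expr1n mul1r.
Qed.

Lemma spec1_dhomogE d t : t \is d.-homog ->
  spec 1 t = \sum_(m <- msupp t) t@_m *: 'X_[mnm_behead m].
Proof.
move=> td; rewrite {1}[t]mpolyE rmorph_sum /=; apply: eq_bigr => m _.
by rewrite specZ spec1_X.
Qed.

Lemma msize_spec1 d t : t \is d.-homog -> (msize (spec 1 t) <= d.+1)%N.
Proof.
move=> td; rewrite (spec1_dhomogE td) big_seq.
apply: leq_trans (msize_sum _ _ _) _.
apply/bigmax_leqP_seq => m mt _; apply: leq_trans (msizeZ_le _ _) _.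
by rewrite msizeX ltnS -(dhomog_mf td mt) /= mdeg_behead leq_addl.
Qed.

(** In a monomial of degree $d$ the exponent of $D_0$ is $d$ minus the degree in the other
    variables, so setting $D_0=1$ loses nothing. *)
Lemma homogenize_spec1 d t : t \is d.-homog -> homogenize d (spec 1 t) = t.
Proof.
move=> td; rewrite (spec1_dhomogE td) linear_sum [RHS]mpolyE.
rewrite big_seq [RHS]big_seq; apply: eq_bigr => m mt /=.
rewrite linearZ /= mpolyX_behead; congr (_ *: _).
rewrite /homogenize msuppX big_seq1 mcoeffX eqxx scale1r.
by rewrite -(dhomog_mf td mt) /= mdeg_behead addnK.
Qed.

End Specialization.

(** * Twisted degrees, homogeneous components, exactness degree by degree *)

Section GradedParts.
Variables (F : fieldType) (n : nat).
Local Notation S := {mpoly F[n]}.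

Lemma twsize_leP (m : nat) (a : 'I_m -> nat) (f : 'cV[S]_m) d :
  (twsize a f <= d)%N <->
  forall i, f i 0 != 0 -> (a i + msize (f i 0%R) <= d)%N.
Proof. by split=> [/bigmax_leqP|h]; [|apply/bigmax_leqP]. Qed.

Lemma twsize_le0 (m : nat) (a : 'I_m -> nat) (f : 'cV[S]_m) :
  (twsize a f <= 0)%N -> f = 0.
Proof.
move=> /twsize_leP h; apply/colP => i; rewrite mxE.
apply: contraTeq isT => nz_f; move/(_ i nz_f): h.
by rewrite leqn0 addn_eq0 msize_poly_eq0 (negPf nz_f) andbF.
Qed.

Lemma twsize0 (m : nat) (a : 'I_m -> nat) : twsize a (0 : 'cV[S]_m) = 0%N.
Proof. by rewrite /twsize big_pred0 // => i; rewrite mxE eqxx. Qed.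

Lemma twsizeB (m : nat) (a : 'I_m -> nat) (f g : 'cV[S]_m) d :
  (twsize a f <= d)%N -> (twsize a g <= d)%N -> (twsize a (f - g) <= d)%N.
Proof.
move=> /twsize_leP hf /twsize_leP hg; apply/twsize_leP => i; rewrite !mxE.
have [->|nf] := eqVneq (f i 0) 0.
  by rewrite sub0r oppr_eq0 msizeN => /hg.
have [->|ng] := eqVneq (g i 0) 0; first by rewrite subr0 => /hf.
move=> _; apply: leq_trans (leq_add (leqnn _) (msizeD_le _ _)) _.
by rewrite msizeN addn_maxr geq_max hf ?hg.
Qed.

(** The projection of $S^m(-a)$ to degree [d]. The test is essential: for [a i > d] truncated
    subtraction would select the constant term of the entry. *)
Definition gpart (m : nat) (a : 'I_m -> nat) d (f : 'cV[S]_m) : 'cV[S]_m :=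
  \col_i if (a i <= d)%N then pihomog mdeg (d - a i) (f i 0) else 0.

Lemma gpart_is_zmod_morphism m (a : 'I_m -> nat) d : zmod_morphism (gpart a d).
Proof.
move=> f g; apply/colP => i; rewrite !mxE.
by case: ifP => _; rewrite ?linearB ?subr0.
Qed.

HB.instance Definition _ m (a : 'I_m -> nat) d :=
  GRing.isZmodMorphism.Build _ _ (gpart a d) (gpart_is_zmod_morphism a d).

Lemma gpartP m (a : 'I_m -> nat) d f : graded_part a d (gpart a d f).
Proof.
move=> i; rewrite !mxE; case: ifP => ad; [right|by left].
by split=> //; apply: pihomogP.
Qed.

Lemma gpart_id m (a : 'I_m -> nat) d f : graded_part a d f -> gpart a d f = f.
Proof.
move=> fd; apply/colP => i; rewrite !mxE.
have [->|[-> fi]] := fd i; first by rewrite linear0 if_same.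
exact: pihomog_dE.
Qed.

Lemma gpart_neq m (a : 'I_m -> nat) d e f :
  d != e -> graded_part a e f -> gpart a d f = 0.
Proof.
move=> de fe; apply/colP => i; rewrite !mxE.
case: ifP => // ad; have [->|[ae fi]] := fe i; first by rewrite linear0.
by apply: pihomog_ne0 fi; rewrite eqn_sub2rE // eq_sym.
Qed.

Lemma msize_dhomog d (t : S) : t \is d.-homog -> (msize t <= d.+1)%N.
Proof.
move=> td; rewrite msizeE; apply/bigmax_leqP_seq => m mt _.
by rewrite ltnS -(dhomog_mf td mt).
Qed.

Lemma pihomog_eq0 d (t : S) : (msize t <= d.+1)%N ->
  pihomog mdeg d t = 0 <-> (msize t <= d)%N.
Proof.
move=> td; split=> [t0|le_td].
  rewrite (pihomog_partitionE td) big_ord_recr /= t0 addr0.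
  apply: leq_trans (msize_sum _ _ _) _; apply/bigmax_leqP => e _.
  exact: leq_trans (msize_dhomog (pihomogP _ _ _)) _.
rewrite pihomogE big_seq_cond big1 // => m /andP[/msize_mdeg_lt mt /eqP md].
by move: mt; rewrite md ltnNge le_td.
Qed.

Lemma graded_part_tw_le m (a : 'I_m -> nat) d (f : 'cV[S]_m) :
  graded_part a d f -> tw_le a d f.
Proof.
move=> fd; apply/twsize_leP => i; have [->|[ad fi] _] := fd i.
  by rewrite eqxx.
apply: leq_trans (leq_add (leqnn _) (msize_dhomog fi)) _.
by rewrite addnS subnKC.
Qed.

(** Zero entries put no constraint on [a i] and are set apart; for the others the subtraction
    [d - a i] is not truncated. *)
Lemma tw_le_entry m (a : 'I_m -> nat) d (f : 'cV[S]_m) i : tw_le a d f ->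
  f i 0 = 0 \/ (a i <= d)%N /\ (msize (f i 0%R) <= (d - a i).+1)%N.
Proof.
move=> /twsize_leP fd; have [->|nz] := eqVneq (f i 0) 0; [by left|right].
have := fd i nz; have : (0 < msize (f i 0%R))%N.
  by rewrite lt0n msize_poly_eq0.
move=> s0 h.
have ad : (a i <= d)%N by rewrite -ltnS (leq_trans _ h) // -addn1 leq_add2l.
by rewrite -subSn // leq_subRL // (leq_trans ad).
Qed.

(** As [twsize] is the degree plus one, the right side says that the degree is below [d]: killing
    the leading part is the same as lowering the degree. *)
Lemma gpart_eq0 m (a : 'I_m -> nat) d (f : 'cV[S]_m) : tw_le a d f ->
  gpart a d f = 0 <-> (twsize a f <= d)%N.
Proof.
move=> /tw_le_entry fd; split=> [f0|/twsize_leP le_fd].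
  apply/twsize_leP => i nz; have [f0i|[ad fi]] := fd i.
    by rewrite f0i eqxx in nz.
  move/colP/(_ i): f0; rewrite !mxE ad => /(pihomog_eq0 fi) le_fi.
  by rewrite -leq_subRL.
apply/colP => i; rewrite !mxE; case: ifP => // ad.
have [->|nz] := eqVneq (f i 0) 0; first by rewrite linear0.
have le_fi : (msize (f i 0%R) <= d - a i)%N by rewrite leq_subRL // le_fd.
by apply/pihomog_eq0 => //; apply: leqW.
Qed.

Lemma gpart_sum m (a : 'I_m -> nat) N f : (twsize a f <= N)%N ->
  f = \sum_(d < N) gpart a d f.
Proof.
move=> /twsize_leP fN; apply/colP => i; rewrite summxE.
under eq_bigr do rewrite mxE.
have [f0|/fN aN] := eqVneq (f i 0) 0.
  by rewrite f0 big1 // => d _; rewrite linear0 if_same.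
have aN' := leq_trans (leq_addr _ _) aN.
(* Degrees below [a i] contribute nothing; shifting the others by [a i] gives the usual
   decomposition of the entry. *)
rewrite -(subnKC aN') big_split_ord /= big1 ?add0r => [|d _]; last first.
  by rewrite leqNgt ltn_ord.
rewrite {1}(@pihomog_partitionE _ _ mdeg (N - a i) (f i 0)); last first.
  by rewrite leq_subRL.
by apply: eq_bigr => d _; rewrite leq_addr addKn.
Qed.

Lemma graded_part_mulmx m k (a : 'I_m -> nat) (b : 'I_k -> nat)
    (M : 'M[S]_(m, k)) :
  (forall i j, M i j = 0 \/
     ((a i <= b j)%N /\ M i j \is (b j - a i).-homog)) ->
  forall d f, graded_part b d f -> graded_part a d (M *m f).
Proof.
move=> hM d f hf i; rewrite mxE; have [ad|da] := leqP (a i) d.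
  right; split=> //; apply: rpred_sum => j _.
  have [->|[ab Mij]] := hM i j; first by rewrite mul0r dhomog0.
  have [->|[bd fj]] := hf j; first by rewrite mulr0 dhomog0.
  have -> : (d - a i = (b j - a i) + (d - b j))%N.
    by rewrite addnC addnBA // subnK.
  exact: dhomogM.
left; apply: big1 => j _.
have [->|[ab _]] := hM i j; first by rewrite mul0r.
have [->|[bd _]] := hf j; first by rewrite mulr0.
by move: da; rewrite ltnNge (leq_trans ab).
Qed.

(** Split [f] into components: [M] sends each one to its own degree, so only that of degree [d]
    reaches degree [d]. *)
Lemma gpart_mulmx m k (a : 'I_m -> nat) (b : 'I_k -> nat) (M : 'M[S]_(m, k)) :
  (forall d f, graded_part b d f -> graded_part a d (M *m f)) ->
  forall d f, gpart a d (M *m f) = M *m gpart b d f.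
Proof.
move=> hM d f; set N := maxn d.+1 (twsize b f).
have dN : (d < N)%N by apply: leq_maxl.
rewrite {1}(@gpart_sum _ b N f) ?leq_maxr // mulmx_sumr raddf_sum.
rewrite (bigD1 (Ordinal dN)) //= big1 ?addr0 => [|e ne].
  exact/gpart_id/hM/gpartP.
apply: gpart_neq (hM _ _ (gpartP _ _ _)).
by rewrite eq_sym; apply: contra ne => /eqP eqd; apply/eqP/val_inj.
Qed.

Lemma graded_exactE p l (a : forall k, 'I_(p k) -> nat)
    (M : forall k, 'M[S]_(p k, p k.+1)) :
  graded_exact l a M <->
  forall d, exact_left l M (fun k => graded_part (@a k) d).
Proof.
split=> [[gM [_ exM injM]] d | exM].
  split=> [k kl f|k kl f fd|k kl f fd]; [exact: gM| |exact: injM].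
  split=> [/(exM k kl f I)[g _ fE]|[g _ fE]].
    (* A preimage need not be homogeneous; its component of degree [d] is still a preimage. *)
    exists (gpart (@a k.+2) d g); first exact: gpartP.
    rewrite -(gpart_mulmx (a := @a k.+1)) => [|e]; last exact: gM.
    by rewrite -fE gpart_id.
  by apply/(exM k kl f I); exists g.
have gM d k (kl : (k < l)%N) : forall f : 'cV[S]_(p k.+1),
  graded_part (@a k.+1) d f -> graded_part (@a k) d (M k *m f).
  by have [h _ _] := exM d; apply: h.
have gpM d k (kl : (k < l)%N) f :
    gpart (@a k) d (M k *m f) = M k *m gpart (@a k.+1) d f.
  by apply: gpart_mulmx => e; apply: gM.
split=> //; split=> // k kl f _.
  split=> [Mf0|[g _ ->]].
    (* Each component of a cycle is a cycle, hence a boundary; the finitely many preimages are then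
       added up. *)
    have fd d : exists g, gpart (@a k.+1) d f = M k.+1 *m g.
      have [_ /(_ k kl _ (gpartP _ d f)) [h _] _] := exM d.
      have [|g _ ->] := h; last by exists g.
      by rewrite -gpM ?(ltnW kl) // Mf0 raddf0.
    rewrite (gpart_sum (leqnn (twsize (@a k.+1) f))).
    elim: (twsize _ _) => [|N [g _ IH]].
      by exists 0 => //; rewrite big_ord0 mulmx0.
    have [h hE] := fd N; exists (g + h) => //.
    by rewrite big_ord_recr /= IH hE mulmxDr.
  rewrite (gpart_sum (leqnn (twsize (@a k.+2) g))) !mulmx_sumr.
  apply: big1 => d _; have [h ex _] := exM d.
  by apply/ex => //; [apply: h => //; apply: gpartP|eexists; [apply: gpartP|]].
move=> Mf0; rewrite (gpart_sum (leqnn (twsize (@a k.+1) f))).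
apply: big1 => d _; have [_ _ inj] := exM d.
apply: (inj k kl); first exact: gpartP.
by rewrite -gpM ?Mf0 ?raddf0 // -kl.
Qed.

End GradedParts.

(** * Homogenization of vectors with respect to a twisting function *)

Section TwistedHomogenization.
Variables (F : fieldType) (n m : nat) (a : 'I_m -> nat).
Local Notation S := {mpoly F[n]}.
Local Notation T := {mpoly F[n.+1]}.
Implicit Types (d : nat) (f : 'cV[S]_m) (w : 'cV[T]_m).

(** For [f] of twisted degree at most [d] this is $D_0^d\,D_0^{-a} f(D_1/D_0,\ldots,D_n/D_0)$. *)
Definition thomogenize d f : 'cV[T]_m :=
  \col_i homogenize (d - a i) (f i 0).

Lemma thomogenize_graded d f : tw_le a d f ->
  graded_part a d (thomogenize d f).
Proof.
move=> /tw_le_entry fd i; rewrite mxE.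
have [->|[ad fi]] := fd i; first by left; rewrite linear0.
by right; split=> //; apply: homogenize_dhomog.
Qed.

Lemma thomogenizeK d f : map_mx (spec 1) (thomogenize d f) = f.
Proof. by apply/colP => i; rewrite !mxE spec1_homogenize. Qed.

Lemma spec0_thomogenize d f : tw_le a d f ->
  map_mx (spec 0) (thomogenize d f) = gpart a d f.
Proof.
move=> /tw_le_entry fd; apply/colP => i; rewrite !mxE.
have [->|[-> fi]] := fd i; first by rewrite !linear0 rmorph0 if_same.
exact: spec0_homogenize.
Qed.

Lemma spec1_tw_le d w : graded_part a d w -> tw_le a d (map_mx (spec 1) w).
Proof.
move=> wd; apply/twsize_leP => i; rewrite mxE.
have [->|[ad wi]] := wd i; first by rewrite rmorph0 eqxx.
move=> _; apply: leq_trans (leq_add (leqnn _) (msize_spec1 wi)) _.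
by rewrite addnS subnKC.
Qed.

Lemma spec1_thomogenizeK d w : graded_part a d w ->
  thomogenize d (map_mx (spec 1) w) = w.
Proof.
move=> wd; apply/colP => i; rewrite !mxE.
have [->|[_ wi]] := wd i; first by rewrite rmorph0 linear0.
exact: homogenize_spec1.
Qed.

Lemma thomogenize0 d : thomogenize d 0 = 0.
Proof. by apply/colP => i; rewrite !mxE linear0. Qed.

End TwistedHomogenization.

Lemma tw_le0 (F : fieldType) n m d (f : 'cV[{mpoly F[n]}]_m) :
  tw_le (fun=> 0%N) d f <-> forall i, (msize (f i 0%R) <= d.+1)%N.
Proof.
split=> [/twsize_leP h i|h]; last by apply/twsize_leP => i _; exact: h.
by have [->|/h//] := eqVneq (f i 0) 0; rewrite msize0.
Qed.

(** * Gradings of $G^H$ and $G^L$, and the specializations of $G^H$ *)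

Section Main.
Variables (F : fieldType) (n l : nat) (p : nat -> nat).
Variable G : forall k : nat, 'M[{mpoly F[n]}]_(p k, p k.+1).
Local Notation S := {mpoly F[n]}.
Local Notation T := {mpoly F[n.+1]}.
Local Notation a k := (@coldeg F n p G k).
Local Notation GH := (cplxH G).
Local Notation GL := (cplxL G).

Lemma coldeg_entry k i j : G k i j = 0 \/
  (a k i <= a k.+1 j)%N /\ (msize (G k i j) <= (a k.+1 j - a k i).+1)%N.
Proof.
have := @tw_le_entry _ _ _ (a k) (a k.+1 j) (col j (G k)) i.
(* [coldeg] is the predecessor of [twsize], and [tw_le] adds the one back. *)
by rewrite mxE; apply; apply: leqSpred.
Qed.

Lemma cplxH_graded k d w : graded_part (a k.+1) d w ->
  graded_part (a k) d (GH k *m w).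
Proof.
apply: graded_part_mulmx => i j; rewrite mxE.
have [->|[aa Gij]] := coldeg_entry i j; first by left; rewrite linear0.
by right; split=> //; apply: homogenize_dhomog.
Qed.

Lemma cplxL_graded k d f : graded_part (a k.+1) d f ->
  graded_part (a k) d (GL k *m f).
Proof.
apply: graded_part_mulmx => i j; rewrite mxE.
by case: ifP => aa; [right; split=> //; apply: pihomogP|left].
Qed.

Lemma spec1_cplxH k : map_mx (spec 1) (GH k) = G k.
Proof. by apply/matrixP => i j; rewrite !mxE spec1_homogenize. Qed.

Lemma spec0_cplxH k : map_mx (spec 0) (GH k) = GL k.
Proof.
apply/matrixP => i j; rewrite !mxE.
have [->|[-> Gij]] := coldeg_entry i j.
  by rewrite !linear0 rmorph0 if_same.
exact: spec0_homogenize.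
Qed.

(** The left side is graded of degree [d], hence recovered from its value at $D_0=1$, which is
    [G k *m f]. *)
Lemma cplxH_thomogenize k d f : tw_le (a k.+1) d f ->
  GH k *m thomogenize (a k.+1) d f = thomogenize (a k) d (G k *m f).
Proof.
move=> fd; have := cplxH_graded (thomogenize_graded fd).
by move/spec1_thomogenizeK <-; rewrite map_mxM spec1_cplxH thomogenizeK.
Qed.

(** Homogenize [f], apply $G^H$, which respects the gradings, and set $D_0=1$. *)
Lemma tw_le_mulmx k d f : tw_le (a k.+1) d f -> tw_le (a k) d (G k *m f).
Proof.
move=> fd; rewrite -(thomogenizeK (a k.+1) d f) -(spec1_cplxH k) -map_mxM.
exact/spec1_tw_le/cplxH_graded/thomogenize_graded.
Qed.

(* Set D_0 = 0 in the homogenization of the product. *)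
Lemma gpart_mulmx_lead k d f : tw_le (a k.+1) d f ->
  gpart (a k) d (G k *m f) = GL k *m gpart (a k.+1) d f.
Proof.
move=> fd; rewrite -(spec0_thomogenize (tw_le_mulmx fd)).
by rewrite -cplxH_thomogenize // map_mxM spec0_cplxH spec0_thomogenize.
Qed.

(** * Equivalence of (a) and (b) *)

(** [thomogenize] and [spec 1] are mutually inverse and intertwine [G] with [GH], so each clause
    transports; the first three bullets go from [G] to [GH], the last three back. *)
Lemma exact_left_cplxH d :
  exact_left l G (fun k => tw_le (a k) d) <->
  exact_left l GH (fun k => graded_part (a k) d).
Proof.
split=> [[_ ex inj]|[_ ex inj]]; split.
- by move=> k _ w; apply: cplxH_graded.
- move=> k kl w wd; have hw := cplxH_graded wd.
  have [h1 h2] := ex k kl _ (spec1_tw_le wd); split=> [w0|[g gd wE]].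
    have [|g gd wE] := h1; first by rewrite -spec1_cplxH -map_mxM w0 map_mx0.
    exists (thomogenize (a k.+2) d g); first exact: thomogenize_graded.
    by rewrite cplxH_thomogenize // -wE spec1_thomogenizeK.
  rewrite -(spec1_thomogenizeK hw) map_mxM spec1_cplxH h2 ?thomogenize0 //.
  exists (map_mx (spec 1) g); first exact: spec1_tw_le.
  by rewrite wE map_mxM spec1_cplxH.
- move=> k kl w wd w0; rewrite -(spec1_thomogenizeK wd).
  have -> : map_mx (spec 1) w = 0; last exact: thomogenize0.
  apply: (inj k kl); first exact: spec1_tw_le.
  by rewrite -spec1_cplxH -map_mxM w0 map_mx0.
- by move=> k _ f; apply: tw_le_mulmx.
- move=> k kl f fd; have [h1 h2] := ex k kl _ (thomogenize_graded fd).
  rewrite cplxH_thomogenize // in h1 h2; split=> [f0|[g gd fE]].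
    have [|g gd wE] := h1; first by rewrite f0 thomogenize0.
    exists (map_mx (spec 1) g); first exact: spec1_tw_le.
    by rewrite -(thomogenizeK (a k.+1) d f) wE map_mxM spec1_cplxH.
  rewrite -(thomogenizeK (a k) d (G k *m f)) h2 ?map_mx0 //.
  exists (thomogenize (a k.+2) d g); first exact: thomogenize_graded.
  by rewrite cplxH_thomogenize // -fE.
- move=> k kl f fd f0; rewrite -(thomogenizeK (a k.+1) d f).
  have -> : thomogenize (a k.+1) d f = 0; last exact: map_mx0.
  apply: (inj k kl); first exact: thomogenize_graded.
  by rewrite cplxH_thomogenize // f0 thomogenize0.
Qed.

Lemma sub_le_im_mx d c : sub_le (im_mx (G 0%N)) d c <->
  im_mx (G 0%N) c /\ tw_le (a 0%N) d c.
Proof. by split=> [[? /tw_le0]|[? /tw_le0]]. Qed.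

(** In degree [d], the equality $\mathrm{Im}(G_1^H)=C^H$ becomes the exactness of the PD sequence at
    $C_{\le d}$. *)
Lemma hgen_im_cplxH :
  (forall v, im_mx (GH 0%N) v <-> hgen (im_mx (G 0%N)) v) <->
  (forall d c, sub_le (im_mx (G 0%N)) d c <->
     exists2 f, tw_le (a 1%N) d f & c = G 0%N *m f).
Proof.
have homE d c : map_mx (homogenize d) c = thomogenize (a 0%N) d c.
  by apply/colP => i; rewrite !mxE subn0.
split=> [imH d c|PD0 v].
  split=> [cd|[f fd ->]]; last first.
    by apply/sub_le_im_mx; split; [exists f|apply: tw_le_mulmx].
  have [_ cd'] := iffLR (sub_le_im_mx d c) cd.
  have /imH[g gE] : hgen (im_mx (G 0%N)) (thomogenize (a 0%N) d c).
    (* A family concentrated in degree [d], the last index of the sum. *)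
    exists d.+1, (fun e => if e == d then thomogenize (a 0%N) d c else 0).
    split=> [e|].
      have [->|_] := eqVneq e d; first by exists c.
      exists 0; last by apply/colP => i; rewrite !mxE linear0.
      by split; [exists 0; rewrite mulmx0|move=> i; rewrite mxE msize0].
    by rewrite big_ord_recr /= eqxx big1 ?add0r // => e _; rewrite ltn_eqF.
  (* The preimage [g] may have components in all degrees; only the one of degree [d] contributes to
     the target. *)
  exists (map_mx (spec 1) (gpart (a 1%N) d g)); first exact/spec1_tw_le/gpartP.
  rewrite -(spec1_cplxH 0) -map_mxM -(gpart_mulmx (a := a 0%N)).
    by rewrite -gE gpart_id ?thomogenizeK //; apply: thomogenize_graded.
  by move=> e f; apply: cplxH_graded.
split=> [[g ->]|[N [w [wd ->]]]].
  exists (twsize (a 1%N) g), (fun d => GH 0%N *m gpart (a 1%N) d g).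
  split=> [d|]; last by rewrite -mulmx_sumr -gpart_sum.
  exists (G 0%N *m map_mx (spec 1) (gpart (a 1%N) d g)).
    apply/PD0; exists (map_mx (spec 1) (gpart (a 1%N) d g)) => //.
    exact/spec1_tw_le/gpartP.
  rewrite homE -cplxH_thomogenize ?spec1_thomogenizeK //.
    exact: gpartP.
  exact/spec1_tw_le/gpartP.
elim: N => [|N [g IH]]; first by exists 0; rewrite big_ord0 mulmx0.
have [c /PD0[f fN ->] wE] := wd N.
exists (g + thomogenize (a 1%N) N f).
by rewrite big_ord_recr /= IH wE homE mulmxDr cplxH_thomogenize.
Qed.

Lemma PD_iff_cplxH : PD l G <->
  (forall v, im_mx (GH 0%N) v <-> hgen (im_mx (G 0%N)) v) /\
  graded_exact l (@coldeg F n p G) GH.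
Proof.
split=> [pd|[/hgen_im_cplxH im /graded_exactE ex] d].
  split; first by apply/hgen_im_cplxH => d; have [] := pd d.
  by apply/graded_exactE => d; apply/exact_left_cplxH; have [] := pd d.
by split; [apply/exact_left_cplxH|apply: im].
Qed.

(* PD for a polynomial resolution; bounding twsize by d instead of d.+1 also
   covers the degree bound -1, i.e. G k *m f = 0. *)
Definition strict : Prop :=
  forall k d (f : 'cV[S]_(p k.+1)), (k < l)%N ->
  (twsize (a k) (G k *m f) <= d)%N ->
  exists2 g, (twsize (a k.+1) g <= d)%N & G k *m f = G k *m g.

(** * Equivalence of (a) and (c), by way of [strict] *)

Hypothesis l_gt0 : (0 < l)%N.
Hypothesis GG0 : forall k, (k.+1 < l)%N -> G k *m G k.+1 = 0.

(** Every vector lies in some truncation, so exactness of all truncations gives a resolution.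
    Conversely, [strict] replaces a preimage given by the resolution with one of bounded degree. *)
Lemma PD_strict : PD l G <-> poly_resolution l G /\ strict.
Proof.
split=> [pd|[[_ ex inj] st] d].
  have tw_leT k (f : 'cV[S]_(p k)) : tw_le (a k) (twsize (a k) f) f.
    exact: leqnSn.
  split.
    split=> // k kl f _.
      have [[_ ex _] _] := pd (twsize (a k.+1) f).
      split=> [/(ex k kl f (tw_leT _ _))[g _ fE]|[g _ ->]]; first by exists g.
      by rewrite mulmxA GG0 // mul0mx.
    have [[_ _ inj] _] := pd (twsize (a k.+1) f).
    by apply: inj.
  move=> k [|d] f kl fd.
    (* The bound 0 forces [G k *m f] to vanish. *)
    exists 0; first by rewrite twsize0.
    by rewrite (twsize_le0 fd) mulmx0.
  have [[_ ex _] im] := pd d.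
  (* For the first matrix the preimage comes from exactness at $C_{\le d}$; for the others, from
     [G k.+1 *m f] being a cycle of degree at most [d]. *)
  case: k => [|k] in f kl fd *.
    by apply/im/sub_le_im_mx; split; first by exists f.
  by apply/(ex k kl) => //; rewrite mulmxA GG0 // mul0mx.
split; first split.
- by move=> k _ f; apply: tw_le_mulmx.
- move=> k kl f fd; split=> [/(ex k kl f I)[g _ fE]|[g _ ->]].
    have [|h hd hE] := st k.+1 d.+1 g kl; first by rewrite -fE.
    by exists h; rewrite ?fE.
  by rewrite mulmxA GG0 // mul0mx.
- by move=> k kl f _; apply: inj.
move=> c; split=> [/sub_le_im_mx[[f ->] cd]|[f fd ->]]; first exact: st.
by apply/sub_le_im_mx; split; [exists f|apply: tw_le_mulmx].
Qed.

(** The leading part of [G k *m f] is [GL k *m f = 0], so [strict] yields [g] of degree below [d]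
    with the same image; [f - g] is a cycle with leading part [f]. *)
Lemma strict_lift_ker k d f : strict -> (k < l)%N ->
  graded_part (a k.+1) d f -> GL k *m f = 0 ->
  exists2 f', tw_le (a k.+1) d f' & G k *m f' = 0 /\ f = gpart (a k.+1) d f'.
Proof.
move=> st kl fd f0; have fd' := graded_part_tw_le fd.
have [|g gd GfE] := st k d f kl.
  apply/gpart_eq0; first exact: tw_le_mulmx.
  by rewrite gpart_mulmx_lead // gpart_id.
exists (f - g); first by apply: twsizeB => //; apply: leqW.
split; first by rewrite mulmxBr GfE subrr.
by rewrite raddfB /= gpart_id // (iffRL (gpart_eq0 _)) ?subr0 //; apply: leqW.
Qed.

(** Forward, a cycle of $G^L$ lifts to a cycle of [G], and the leading part of a bounded preimage of
    the lift is the required preimage. Backward, [f] is modified without changing [G k *m f] until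
    its size is at most [d], by induction on a bound for that size. *)
Lemma strict_cplxL :
  poly_resolution l G -> strict <-> graded_exact l (@coldeg F n p G) GL.
Proof.
move=> [_ ex inj]; split=> [st|[_ [_ exL injL]]].
  apply/graded_exactE => d; split.
  - by move=> k _ f; apply: cplxL_graded.
  - move=> k kl f fd; split=> [f0|[g gd ->]].
      have [f' fd' [f'0 ->]] := strict_lift_ker st (ltnW kl) fd f0.
      have [g _ f'E] := iffLR (ex k kl f' I) f'0.
      have [|h hd hE] := st k.+1 d.+1 g kl; first by rewrite -f'E.
      exists (gpart (a k.+2) d h); first exact: gpartP.
      by rewrite -gpart_mulmx_lead // f'E hE.
    (* The product of consecutive leading matrices vanishes because it computes the leading part of
       [G k *m (G k.+1 *m g) = 0]. *)
    have gd' := graded_part_tw_le gd.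
    rewrite -(gpart_id gd) -gpart_mulmx_lead // -gpart_mulmx_lead.
      by rewrite mulmxA GG0 // mul0mx raddf0.
    exact: tw_le_mulmx.
  - move=> k kl f fd f0; have kl' : (k < l)%N by rewrite -kl.
    have [f' fd' [f'0 ->]] := strict_lift_ker st kl' fd f0.
    by rewrite (inj k kl f' I f'0) raddf0.
move=> k d f kl Gfd; have [e] := ubnP (twsize (a k.+1) f).
elim: e f Gfd => // e IH f Gfd; rewrite ltnS => fe.
have [le_ed|lt_de] := leqP e d; first by exists f => //; apply: leq_trans le_ed.
(* Since [d < e], the bound is a successor; after renaming, [f] has degree at most [e] and its image
   has degree below [e]. *)
case: e => // e in IH fe lt_de *.
have lead0 : GL k *m gpart (a k.+1) e f = 0.
  rewrite -gpart_mulmx_lead //; apply/gpart_eq0; first exact: tw_le_mulmx.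
  exact: leq_trans Gfd lt_de.
(* Correct f by a boundary to cancel its leading part. *)
have [kl'|] := ltnP k.+1 l; last first.
  (* At the last matrix $G^L$ is injective, so the leading part of [f] is already zero. *)
  move=> lk; have {lk}kl' : k.+1 = l by apply/eqP; rewrite eqn_leq kl lk.
  by apply: IH => //; apply/gpart_eq0 => //; apply: (injL k kl').
have [h _ hE] := iffLR (exL k kl' _ I) lead0.
have he := gpartP (a k.+2) e h; have he' := graded_part_tw_le he.
set f' := f - G k.+1 *m gpart (a k.+2) e h.
have GfE : G k *m f' = G k *m f.
  by rewrite mulmxBr mulmxA GG0 // mul0mx subr0.
rewrite -GfE in Gfd *; apply: IH => //.
have f'e : tw_le (a k.+1) e f' by apply: twsizeB => //; apply: tw_le_mulmx.
(* The correction has the same component of degree [e] as [f], so the difference has smaller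
   size. *)
apply/gpart_eq0 => //; rewrite raddfB /= gpart_mulmx_lead // (gpart_id he).
rewrite -(gpart_mulmx (a := a k.+1)) => [|e' g]; last exact: cplxL_graded.
by rewrite -hE (gpart_id (gpartP _ _ _)) subrr.
Qed.

End Main.

Theorem theorem1 (F : fieldType) (n l : nat) (p : nat -> nat)
    (G : forall k : nat, 'M[{mpoly F[n]}]_(p k, p k.+1))
    (n_gt0 : (0 < n)%N) (cplxG : poly_complex l G) :
  let a := @coldeg F n p G in
  let C := im_mx (G 0%N) in
  let condA := PD l G in
  let condB := (forall v : 'cV[{mpoly F[n.+1]}]_(p 0%N),
                  im_mx (cplxH G 0%N) v <-> hgen C v)
               /\ graded_exact l a (cplxH G) in
  let condC := poly_resolution l G /\ graded_exact l a (cplxL G) in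
  (condA <-> condB) /\ (condB <-> condC).
Proof.
move=> a C condA condB condC; have [l_gt0 _ _ GG0] := cplxG.
have AB : condA <-> condB by apply: PD_iff_cplxH.
have AC : condA <-> condC.
  rewrite /condA PD_strict //.
  by split=> [[res st]|[res exL]]; split=> //; apply/(strict_cplxL GG0 res).
by split=> //; rewrite -AB.
Qed.
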